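(* The family $\mathcal{TSF}$ of all topologically space-filling curves $I\to\mathbb{R}^2$ is maximal dense-lineable in $C(I,\mathbb{R}^2)$. Hence the family $\lambda$-$\mathcal{SF}$ of all $\lambda$-space-filling curves $I\to\mathbb{R}^2$ is maximal dense-lineable in $C(I,\mathbb{R}^2)$ as well.
   Context: $I=[0,1]$. $C(I,\mathbb{R}^2)$ is the real vector space of continuous functions $I\to\mathbb{R}^2$, endowed with the topology of uniform convergence on $I$. A topologically space-filling curve is a continuous mapping $\varphi:I\to\mathbb{R}^2$ such that $\varphi(I)$ has nonempty interior in $\mathbb{R}^2$. A $\lambda$-space-filling curve is a continuous mapping $\varphi:I\to\mathbb{R}^2$ with $\lambda(\varphi(I))>0$, where $\lambda$ is Lebesgue measure on $\mathbb{R}^2$. A subset $A$ of a topological vector space $X$ is maximal dense-lineable in $X$ if there is a dense vector subspace $M$ of $X$ with $M\setminus\{0\}\subset A$ and $\dim(M)=\dim(X)$ (as cardinal numbers, algebraic dimension). *)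

(* Defs.v *)
From HB Require Import structures.
From mathcomp Require Import all_boot all_order all_algebra.
From mathcomp Require Import all_classical all_reals all_analysis.

Set Implicit Arguments.
Unset Strict Implicit.
Unset Printing Implicit Defensive.

Import Order.TTheory GRing.Theory Num.Theory.
Import numFieldNormedType.Exports.

Local Open Scope classical_set_scope.
Local Open Scope ring_scope.

Definition unit_interval (R : realType) : set R := `[0, 1].
Arguments unit_interval : clear implicits.

(* C(I, R^2). The set [unit_interval R], used as a type, carries the
   subspace topology. *)
Definition curve (R : realType) : Type :=
  continuousType (unit_interval R) (R * R)%type.

HB.instance Definition _ (R : realType) := Choice.on (curve R).

Section curve_lmodule.
Variable R : realType.
Local Notation I := (unit_interval R).

Definition curve_fun (f : curve R) : I -> R * R := f.

Definition cts_pred : {pred I -> R * R} :=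
  mem [set f : I -> R * R | continuous f].

Section Sub.
Context (f : I -> R * R) (fP : f \in cts_pred).
#[local] HB.instance Definition _ := @isContinuous.Build _ _ f (set_mem fP).
Definition curve_Sub : curve R := [the continuousType _ _ of f].
End Sub.

Lemma curve_rect (K : curve R -> Type) :
  (forall f (Pf : f \in cts_pred), K (curve_Sub Pf)) -> forall u, K u.
Proof.
move=> Ksub [f [[Pf1]]].
have Pf : f \in cts_pred by rewrite inE.
have -> : Pf1 = set_mem Pf by [].
exact: Ksub.
Qed.

Lemma curve_valP f (Pf : f \in cts_pred) : curve_fun (curve_Sub Pf) = f.
Proof. by []. Qed.

HB.instance Definition _ := isSub.Build _ _ (curve R) curve_rect curve_valP.

Lemma cts_submod_closed : submod_closed cts_pred.
Proof.
split; first by rewrite inE /=; exact: cst_continuous.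
move=> a f g; rewrite !inE /= => fc gc t.
apply: (@cvgD _ _ _ (nbhs t) _ (fun x => a *: f x) g); last exact: gc.
by apply: (@cvgZ _ _ _ (nbhs t)); [exact: cvg_cst | exact: fc].
Qed.

HB.instance Definition _ :=
  GRing.isSubmodClosed.Build _ _ cts_pred cts_submod_closed.

HB.instance Definition _ := [SubChoice_isSubLmodule of curve R by <:].

(* Topology of uniform convergence; see [nbhs_curveP]. *)
HB.instance Definition _ := Uniform.copy (curve R)
  (initial_topology (fun f : curve R => curve_fun f : {uniform I -> R * R})).

Lemma nbhs_curveP (f : curve R) (P : set (curve R)) :
  nbhs f P <-> exists2 e : R, 0 < e &
    [set g : curve R | forall t, `|f t - g t| < e] `<=` P.
Proof.
split.
- case=> Q [[W oW <-] Wf] QP.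
  have : nbhs (curve_fun f : {uniform I -> R * R}) W.
    by rewrite nbhsE; exists W => //; split.
  case/uniform_nbhs => E [+ EW].
  rewrite -entourage_ballE => -[e /= e0 eE].
  exists e => // g fg; apply: QP; apply: EW => /= t _; apply: eE => /=.
  by rewrite -ball_normE; exact: fg.
- move=> [e e0 eP].
  have : nbhs (curve_fun f : {uniform I -> R * R})
     [set h | forall t, `|curve_fun f t - h t| < e].
    apply/uniform_nbhs; exists [set xy | ball xy.1 e xy.2]; split.
      exact: entourage_ball (PosNum e0).
    by move=> h /= H t; have := H t Logic.I; rewrite -ball_normE.
  rewrite nbhsE => -[W [oW Wf] WP].
  exists ((fun f : curve R => curve_fun f : {uniform I -> R * R}) @^-1` W).
  by split; [exists W | exact: Wf | move=> g Wg; apply: eP; exact: WP Wg].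
Qed.

Lemma curve_bounded (f : curve R) : exists2 M : R, 0 < M & forall t, `|f t| <= M.
Proof.
have cf : {within I, continuous (valL_ 0 (curve_fun f))}.
  by apply/subspace_valL_continuousP'; exact: (@cts_fun _ _ f).
have := continuous_compact cf (@segment_compact R 0 1).
move=> /compact_bounded[N [_ HN]].
exists (`|N| + 1) => [|t]; first by rewrite ltr_wpDl.
apply: (HN (`|N| + 1)); first by rewrite (le_lt_trans (ler_norm _))// ltrDl.
exists (\val t); first exact: set_valP.
exact: (congr1 (fun h => h t) (@valLK _ _ 0 I (curve_fun f))).
Qed.

Lemma curve_add_continuous :
  continuous (fun z : curve R * curve R => z.1 + z.2).
Proof.
move=> [f g] P /nbhs_curveP[e e0 eP].
have e20 : 0 < e / 2 by rewrite divr_gt0.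
exists ([set h : curve R | forall t, `|f t - h t| < e / 2],
        [set h : curve R | forall t, `|g t - h t| < e / 2]) => /=.
  by split; apply/nbhs_curveP; exists (e / 2).
move=> [h k] /= [fh gk]; apply: eP => t /=.
change (`|f t + g t - (h t + k t)| < e).
by rewrite opprD addrACA (splitr e) (le_lt_trans (ler_normD _ _))// ltrD.
Qed.

Lemma curve_scale_continuous :
  continuous (fun z : R^o * curve R => z.1 *: z.2).
Proof.
move=> [a f] P /nbhs_curveP[e e0 eP].
have [M M0 fM] := curve_bounded f.
have b0 : 0 < `|a| + 1 by rewrite ltr_wpDl.
pose d := Num.min 1 (e / 2 / M).
have d0 : 0 < d by rewrite lt_min ltr01 !divr_gt0.
exists ([set b : R^o | `|a - b| < d],
        [set h : curve R | forall t, `|f t - h t| < e / 2 / (`|a| + 1)]) => /=.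
  split; last by apply/nbhs_curveP; exists (e / 2 / (`|a| + 1)); rewrite ?divr_gt0.
  by apply/nbhs_normP; exists d.
move=> [b h] /= [ab fh]; apply: eP => t /=.
change (`|a *: f t - b *: h t| < e).
have -> : a *: f t - b *: h t = (a - b) *: f t + b *: (f t - h t).
  by rewrite scalerBl scalerBr addrA subrK.
have ble : `|b| <= `|a| + 1.
  rewrite -lerBlDl (le_trans (lerB_dist _ _))// distrC ltW// (lt_le_trans ab)//.
  by rewrite ge_min lexx.
rewrite (splitr e) (le_lt_trans (ler_normD _ _))// ltr_leD// !normrZ.
  rewrite (le_lt_trans (ler_wpM2l _ (fM t)))// -ltr_pdivlMr//.
  by rewrite (lt_le_trans ab)// ge_min lexx orbT.
rewrite (le_trans (ler_wpM2r _ ble))// mulrC -ler_pdivlMr//.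
exact/ltW/fh.
Qed.

HB.instance Definition _ :=
  PreTopologicalNmodule_isTopologicalNmodule.Build (curve R)
    curve_add_continuous.
HB.instance Definition _ :=
  TopologicalNmodule_isTopologicalLmodule.Build R (curve R)
    curve_scale_continuous.

End curve_lmodule.

Section lineability.
Variables (R : realType) (X : topologicalLmodType R).
Implicit Types M A B : set X.

Definition lin_span B : set X :=
  [set x | exists (s : seq X) (c : X -> R),
     [set` s] `<=` B /\ x = \sum_(v <- s) c v *: v].

Definition lin_free B := forall (s : seq X) (c : X -> R),
  uniq s -> [set` s] `<=` B -> \sum_(v <- s) c v *: v = 0 ->
  forall v, v \in s -> c v = 0.

Definition hamel_basis B M := lin_free B /\ lin_span B = M.

(* Equality of the algebraic dimensions, as cardinals. Every subspace has a
   Hamel basis and any two of them are equipotent, so the choice of B and C is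
   immaterial. *)
Definition dim_eq M N :=
  exists B C : set X, [/\ hamel_basis B M, hamel_basis C N & (B #= C)%card].

Definition maximal_dense_lineable A :=
  exists M : set X, [/\ submod_closed (mem M), dense M,
    M `\ 0 `<=` A & dim_eq M setT].

End lineability.

Section space_filling.
Variable R : realType.

Definition TSF : set (curve R) :=
  [set phi | interior (range (curve_fun phi)) !=set0].

Definition lambda_SF : set (curve R) :=
  [set phi | (0 < (lebesgue_measure \x lebesgue_measure)
                   (range (curve_fun phi)))%E].

End space_filling.

(* Main.v *)
(* Let P be Schoenberg's Peano curve and let Q_n be a copy of P rescaled to
   parameters of order 4^-n, truncated outside [4^-(n+1), 4^-n]. For a bit
   sequence k put g_k = sum_n c_n(k) 2^-(n+1) Q_n, where c_n(k) is 1 if n codes a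
   finite prefix of k and 0 otherwise. Given finitely many distinct bit
   sequences, infinitely many n code a prefix of a chosen one and of no other, so
   on the corresponding windows a linear combination of the g_k is a multiple of
   a single Q_n. Every nonzero combination thus fills squares arbitrarily close
   to the parameter 0, and still does so after adding a curve that is constant
   near 0.

   There are at most as many curves as bit sequences, so each pair (f, n) gets
   its own bit sequence k(f, n). The curves f(max(t, 2^-n)) + 2^-n g_k(f,n) are
   dense, and their nontrivial linear combinations are space filling; in
   particular they are linearly independent. A Hamel basis of the whole space
   extending this family has the same cardinality by Cantor-Bernstein. *)
Require Import Defs.
From mathcomp Require Import all_boot all_order all_algebra.
From mathcomp Require Import all_classical all_reals all_analysis.

Set Implicit Arguments.
Unset Strict Implicit.
Unset Printing Implicit Defensive.

From mathcomp Require Import ring lra.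
Import Order.TTheory GRing.Theory Num.Theory.
Import numFieldNormedType.Exports.

Local Open Scope classical_set_scope.
Local Open Scope ring_scope.

(** * Hamel bases and lineability *)

Section linear_algebra.
Variables (R : realType) (X : topologicalLmodType R).
Implicit Types (B C : set X) (s t : seq X) (c : X -> R).

Lemma big_uniq_sub s t (F : X -> X) : uniq s -> uniq t -> {subset s <= t} ->
  \sum_(v <- s) F v = \sum_(v <- t | v \in s) F v.
Proof.
move=> us ut st; rewrite -[RHS]big_filter; apply: perm_big.
rewrite uniq_perm ?filter_uniq// => v; rewrite mem_filter.
by case: (boolP (v \in s)) => // /st ->.
Qed.

(** [lin_free] only tests duplicate-free lists; merging equal vectors multiplies a coefficient by
    the multiplicity. *)
Lemma lin_spanP B x : lin_span B x -> exists s c,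
  [/\ uniq s, [set` s] `<=` B & x = \sum_(v <- s) c v *: v].
Proof.
move=> [s [c [sB ->]]].
exists (undup s), (fun v => c v *+ count_mem v s); split.
- exact: undup_uniq.
- by move=> v /=; rewrite mem_undup => /sB.
- rewrite -big_undup_iterop_count; apply: eq_bigr => v _.
  by rewrite -[LHS]/(c v *: v *+ _) scalerMnl.
Qed.

Lemma sub_lin_span B : B `<=` lin_span B.
Proof.
move=> v Bv; exists [:: v], (fun=> 1); split.
  by move=> w /=; rewrite inE => /eqP ->.
by rewrite big_seq1 scale1r.
Qed.

Lemma lin_span_submod B : submod_closed (mem (lin_span B)).
Proof.
split; first by rewrite inE; exists [::], (fun=> 0); split => //; rewrite big_nil.
move=> a x y; rewrite !inE => /lin_spanP[s [c [us sB ->]]].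
move=> /lin_spanP[t [d [ut tB ->]]].
exists (undup (s ++ t)),
  (fun v => (if v \in s then a * c v else 0) + (if v \in t then d v else 0)).
split.
  by move=> v /=; rewrite mem_undup mem_cat => /orP[/sB|/tB].
rewrite scaler_sumr (@big_uniq_sub s (undup (s ++ t))) ?undup_uniq//; last first.
  by move=> v vs; rewrite mem_undup mem_cat vs.
rewrite (@big_uniq_sub t (undup (s ++ t))) ?undup_uniq//; last first.
  by move=> v vt; rewrite mem_undup mem_cat vt orbT.
rewrite [X in X + _]big_mkcond [X in _ + X]big_mkcond/= -big_split/=; apply: eq_bigr => v _.
rewrite scalerDl; congr (_ + _); case: ifPn; rewrite ?scale0r//.
by rewrite scalerA.
Qed.

Lemma lin_free_setU1 B x : lin_free B -> ~ lin_span B x -> lin_free (x |` B).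
Proof.
move=> fB nx s c us sB sum0.
have splitB : [set` rem x s] `<=` B.
  move=> v /=; rewrite (rem_filter x us) mem_filter /= => /andP[/eqP vx /sB].
  by case.
case: (boolP (x \in s)) => xs; last first.
  apply: fB => // v vs; case: (sB _ vs) => // vx.
  by move: xs; rewrite -vx (vs : v \in s).
move: sum0; rewrite (perm_big _ (perm_to_rem xs)) big_cons /= => sum0.
have cx0 : c x = 0.
  apply/eqP/negP => /negP cx; apply: nx.
  exists (rem x s), (fun v => - (c x)^-1 * c v); split => //.
  under eq_bigr do rewrite -scalerA.
  rewrite -scaler_sumr scaleNr; apply: (scalerI cx).
  by rewrite scalerN scalerA divff// scale1r; apply/eqP; rewrite -addr_eq0 sum0.
move: sum0; rewrite cx0 scale0r add0r => /(fB _ _ (rem_uniq x us) splitB) H v vs.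
have [->//|vx] := eqVneq v x.
by apply: H; rewrite (rem_filter x us) mem_filter /= vx.
Qed.

(** Zorn's lemma is applied to the sets [Y] added to [B], so that the empty chain, whose union is
    empty, is also covered. *)
Lemma hamel_basis_extend B : lin_free B ->
  exists2 C, B `<=` C & hamel_basis C setT.
Proof.
move=> fB; pose P (Y : set X) := lin_free (B `|` Y).
have chain F : F `<=` P -> total_on F subset -> P (\bigcup_(Y in F) Y).
  move=> FP Ft.
  (* Along a chain, a finite list lies in [B] together with a single member, so freeness passes to
     the union. *)
  have fin s : [set` s] `<=` B `|` \bigcup_(Y in F) Y ->
      [set` s] `<=` B \/ exists2 Y, F Y & [set` s] `<=` B `|` Y.
    elim: s => [|v s IH] vsB; first by left.
    have sB : [set` s] `<=` B `|` \bigcup_(Y in F) Y.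
      by move=> w /= ws; apply: vsB; rewrite /= inE (ws : w \in s) orbT.
    have cons_sub Z : Z v -> [set` s] `<=` Z -> [set` v :: s] `<=` Z.
      by move=> Zv sZ w /=; rewrite inE => /orP[/eqP -> //|/sZ].
    case: (vsB v) => [|Bv|[Z FZ Zv]]; first by rewrite /= inE eqxx.
      case: (IH sB) => [sB'|[Y FY sY]]; first by left; apply: cons_sub.
      by right; exists Y => //; apply: cons_sub => //; left.
    right; case: (IH sB) => [sB'|[Y FY sY]].
      exists Z => //; apply: cons_sub; first by right.
      by move=> w /sB' ?; left.
    have [YZ|ZY] := Ft _ _ FY FZ.
      exists Z => //; apply: cons_sub; first by right.
      by move=> w /sY[?|/YZ ?]; [left|right].
    by exists Y => //; apply: cons_sub => //; right; exact: ZY.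
  move=> s c us /fin[sB|[Y FY sY]] s0; first exact: fB.
  exact: (FP _ FY s).
have [A [PA maxA]] := Zorn_bigcup chain.
exists (B `|` A); first by left.
split=> //; apply/seteqP; split => // x _; apply: contrapT => nx.
apply: (maxA (x |` A)); last first.
  by rewrite /P setUCA; exact: lin_free_setU1.
split; first by right.
by move=> /(_ x (or_introl erefl)) Ax; apply/nx/sub_lin_span; right.
Qed.

(** As 0 is not in [A], the last hypothesis makes [b] injective with a free range. A Hamel basis of
    [X] containing this range injects into [X], hence into [J], hence into the range, so both have
    the same cardinality. *)
Lemma maximal_dense_lineable_family (J : eqType) (b : J -> X) (A : set X) :
    ([set: X] #<= [set: J])%card -> dense (lin_span (range b)) -> ~ A 0 ->
    (forall (s : seq J) (c : J -> R) j, uniq s -> j \in s -> c j != 0 ->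
      A (\sum_(i <- s) c i *: b i)) ->
  maximal_dense_lineable A.
Proof.
move=> leJ dB A0 comb.
have b_inj : injective b.
  move=> i j bij; apply: contrapT => /eqP ij; apply: A0.
  have ji : (j == i) = false by rewrite eq_sym; exact: negbTE.
  (* If [b i = b j], this combination is [b i - b j = 0]. *)
  have := comb [:: i; j] (fun k => if k == i then 1 else -1) i.
  rewrite big_cons big_seq1 eqxx ji scale1r scaleN1r bij subrr.
  by apply; rewrite ?oner_eq0//= inE ?eqxx ?ij.
have combB s c v : uniq s -> [set` s] `<=` range b -> v \in s -> c v != 0 ->
    A (\sum_(w <- s) c w *: w).
  move=> us sB vs cv.
  have /choice[f fK] (w : X) : exists i, w \in s -> b i = w.
    have [ws|_] := boolP (w \in s); first by have [k _ kw] := sB w ws; exists k.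
    by have [k _ _] := sB _ vs; exists k.
  have sE : s = map b (map f s).
    by rewrite -map_comp -[LHS]map_id; apply/eq_in_map => w /fK /= ->.
  rewrite sE big_map; apply: (comb _ (c \o b) (f v)) => //=.
  - by rewrite -(map_inj_uniq b_inj) -sE.
  - exact: map_f.
  - by rewrite fK.
have fB : lin_free (range b).
  move=> s c us sB sum0 v vs; apply/eqP/negP => /negP cv.
  by apply: A0; rewrite -sum0; exact: (combB _ _ v).
have [C BC hC] := hamel_basis_extend fB.
exists (lin_span (range b)); split=> //; first exact: lin_span_submod.
  move=> x [/lin_spanP[s [c [us sB ->]]]] nz.
  have /hasP[v vs cv] : has (fun v => c v != 0) s.
    apply: contrapT => /negP/hasPn c0; apply: nz; rewrite /= big_seq big1// => v vs.
    by have /negPn/eqP -> := c0 v vs; rewrite scale0r.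
  exact: (combB _ _ v).
exists (range b), C; split => //; rewrite card_eq_le.
rewrite subset_card_le//= (card_le_trans (subset_card_le (@subsetT _ C)))//.
have /card_eqPle[_] : (range b #= [set: J])%card by apply: inj_card_eq => i j _ _ /b_inj.
exact: card_le_trans.
Qed.

Lemma maximal_dense_lineable_sub (A B : set X) :
  A `<=` B -> maximal_dense_lineable A -> maximal_dense_lineable B.
Proof.
by move=> AB [M [? ? MA ?]]; exists M; split => //; exact: subset_trans AB.
Qed.

End linear_algebra.

(** * Schoenberg's curve *)

Section geometric_domination.
Variable R : realType.
Implicit Types (a : R ^nat).

Definition halving n : R := 2^-1 ^+ n.

Lemma halving_gt0 n : 0 < halving n.
Proof. by rewrite exprn_gt0// invr_gt0. Qed.

Lemma halvingS n : halving n = halving n.+1 + halving n.+1.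
Proof. by rewrite /halving exprS; field. Qed.

Lemma halving_le m n : (m <= n)%N -> halving n <= halving m.
Proof. by move=> mn; apply: ler_wiXn2l => //; rewrite invf_le1// ler1n. Qed.

Lemma halving_le1 n : halving n <= 1.
Proof. exact: (@halving_le 0). Qed.

Lemma halving_small (e : R) : 0 < e -> exists n, halving n < e.
Proof.
move=> e0; have : (fun n => halving n) @ \oo --> (0 : R).
  by apply: cvg_expr; rewrite gtr0_norm ?invf_lt1// ltr1n.
move=> /cvgrPdist_lt/(_ e e0)[n _ /(_ n (leqnn _))] /=.
by rewrite sub0r normrN gtr0_norm ?halving_gt0//; exists n.
Qed.

Variable a : R ^nat.
Hypothesis a_le : forall k, `|a k| <= halving k.+1.

Lemma is_cvg_series_halving : cvgn (series a).
Proof.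
apply: normed_cvg.
apply: (@series_le_cvg _ _ (geometric 2^-1 2^-1)) => //.
- by move=> n /=.
- by move=> n; rewrite /= mulr_ge0// exprn_ge0.
- by move=> n; rewrite /= -exprS; exact: a_le.
- by apply: is_cvg_geometric_series; rewrite gtr0_norm ?invf_lt1// ltr1n.
Qed.

(** The terms from [n] to [n + j] are dominated by a telescoping sum. *)
Lemma dist_series_halving n : `|limn (series a) - series a n| <= halving n.
Proof.
have tail j : `|series a (n + j)%N - series a n| <= halving n - halving (n + j)%N.
  elim: j => [|j IH]; first by rewrite addn0 !subrr normr0.
  rewrite addnS {1}/series/= big_nat_recr//= -/(series a (n + j)%N).
  rewrite addrAC (le_trans (ler_normD _ _))//.
  rewrite (le_trans (lerD IH (a_le _)))//.
  by rewrite (halvingS (n + j)%N) opprD addrA subrK.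
apply/ler_addgt0Pr => e e0.
have /cvgrPdist_lt/(_ e e0)[m _ Hm] := is_cvg_series_halving.
have := Hm (n + m)%N (leq_addl _ _) => /= lem.
rewrite (le_trans (ler_distD (series a (n + m)%N) _ _))// addrC.
rewrite lerD ?(ltW lem)// (le_trans (tail m))//.
by rewrite gerBl ltW// halving_gt0.
Qed.

Lemma lim_series_halving_le1 : `|limn (series a)| <= 1.
Proof.
have := dist_series_halving 0.
have -> : series a 0%N = 0 by rewrite /series/= big_geq.
by rewrite subr0.
Qed.

Lemma lim_series_halving_step (b : R ^nat) : (forall k, a k.+1 = b k / 2) ->
  cvgn (series b) -> limn (series a) = a 0 + limn (series b) / 2.
Proof.
move=> ab cb; apply/cvg_lim => //.
rewrite -(cvg_shiftn 1).
have -> : (fun n => series a (n + 1)%N) = (fun n => a 0 + series b n / 2).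
  apply/funext => n; rewrite addn1 /series/= big_nat_recl//; congr (_ + _).
  by rewrite mulr_suml; apply: eq_bigr => k _; exact: ab.
by apply: cvgD; [exact: cvg_cst|apply: cvgMl].
Qed.

End geometric_domination.

Lemma continuous_lim_series (R : realType) (T : topologicalType)
    (u : nat -> T -> R) :
  (forall k, continuous (u k)) -> (forall k t, `|u k t| <= halving R k.+1) ->
  continuous (fun t => limn (series (u ^~ t))).
Proof.
move=> uc ule t; apply/cvgrPdist_lt => e e0.
have e30 : 0 < e / 3 by rewrite divr_gt0.
have [n ne] := halving_small e30.
have : {for t, continuous (fun t => series (u ^~ t) n)}.
  by apply: cvg_big => [|k _]; [exact: add_continuous|exact: uc].
move=> /cvgrPdist_lt/(_ _ e30); apply: filterS => s /= st.
have dn r := dist_series_halving (fun k => ule k r) n.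
have := dn t; have := dn s.
move: st (limn _) (limn _) => + L M.
move: (series _ _) (series _ _) => A B.
rewrite !ltr_norml !ler_norml => /andP[? ?] /andP[? ?] /andP[? ?].
by apply/andP; split; lra.
Qed.

Lemma continuous_clip (R : realType) (T : topologicalType) (f : T -> R) :
  continuous f -> continuous (fun t => Num.max 0 (Num.min 1 (f t))).
Proof.
move=> fc t.
apply: (@continuous_max R T (fun=> 0) (fun t => Num.min 1 (f t))).
  exact: cst_continuous.
apply: (@continuous_min R T (fun=> 1) f); first exact: cst_continuous.
exact: fc.
Qed.

(** * Schoenberg's function and the surjectivity of the associated plane curve *)

Section schoenberg.
Variable R : realType.
Implicit Types (s t x y : R).

(** A clipped cosine in place of Schoenberg's piecewise linear function: continuous, of period 2,
    equal to 0 on [0, 1/5] and to 1 on [1, 6/5]. *)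
Definition digit s : R := Num.max 0 (Num.min 1 (2^-1 - cos (pi * s))).

Lemma digit_ge0 s : 0 <= digit s.
Proof. by rewrite le_max lexx. Qed.

Lemma digit_le1 s : digit s <= 1.
Proof. by rewrite ge_max ler01 ge_min lexx. Qed.

Lemma digit_continuous : continuous digit.
Proof.
apply: continuous_clip => s; apply: cvgB; first exact: cvg_cst.
apply: continuous_comp; last exact: continuous_cos.
by apply: cvgM; [exact: cvg_cst|exact: cvg_id].
Qed.

Lemma digit_periodic n s : digit (s + (2 * n)%:R) = digit s.
Proof.
rewrite /digit mulrDr; congr (Num.max 0 (Num.min 1 (_ - _))).
rewrite -(periodicn (@cosD2pi R) n (pi * s)); congr cos; congr (_ + _).
by rewrite -mulrnA mulr_natr.
Qed.

Lemma cos_pi_ge_half s : 0 <= s <= 5^-1 -> 2^-1 <= cos (pi * s).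
Proof.
move=> /andP[s0 s5]; have pi0 := @pi_gt0 R.
(* Since 1/5 < 1/4, it suffices to bound the cosine at [pi / 4], which the double angle formula
   gives. *)
have : cos (pi / 4) <= cos (pi * s).
  rewrite leNgt ltr_cos ?in_itv/= -?leNgt; first by apply: ler_wpM2l; lra.
    by apply/andP; split; [rewrite divr_ge0// ltW|nra].
  by apply/andP; split; [rewrite mulr_ge0// ltW|nra].
apply: le_trans.
have : 0 < cos (pi / 4 : R) by apply: cos_gt0_pihalf; apply/andP; split; lra.
have : cos ((pi / 4) *+ 2) = 0 :> R.
  by rewrite -cos_pihalf; congr cos; rewrite -mulr_natr; field.
rewrite cos_mulr2n; nra.
Qed.

Lemma digitD (b : bool) s : 0 <= s <= 5^-1 -> digit (b%:R + s) = b%:R.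
Proof.
move=> /cos_pi_ge_half; rewrite /digit; case: b => /= ge_half.
  rewrite mulrDr mulr1 [pi + _]addrC cosDpi min_l ?max_r//; lra.
rewrite add0r max_l// ge_min; apply/orP; right; lra.
Qed.

(* Schoenberg's curve is s |-> (schoenberg s, schoenberg (6 * s)), here in base 6
   instead of 3: since the base is even and [digit] has period 2, [schoenberg]
   has period 1. *)
Definition schoenberg_term s k : R :=
  halving R k.+1 * digit (6 ^+ k.*2.+1 * s).

Definition schoenberg s : R := limn (series (schoenberg_term s)).

Lemma schoenberg_term_le s k : `|schoenberg_term s k| <= halving R k.+1.
Proof.
rewrite normrM (gtr0_norm (halving_gt0 _ _)) (ger0_norm (digit_ge0 _)).
by rewrite ler_piMr ?digit_le1// ltW// halving_gt0.
Qed.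

Lemma schoenberg_le1 s : `|schoenberg s| <= 1.
Proof. exact/lim_series_halving_le1/schoenberg_term_le. Qed.

Lemma schoenberg_continuous : continuous schoenberg.
Proof.
apply: (@continuous_lim_series R R (fun k s => schoenberg_term s k)) => [k s|].
  apply: cvgM; first exact: cvg_cst.
  apply: continuous_comp; last exact: digit_continuous.
  by apply: cvgM; [exact: cvg_cst|exact: cvg_id].
by move=> k s; exact: schoenberg_term_le.
Qed.

Lemma schoenberg_periodic n s : schoenberg (s + n%:R) = schoenberg s.
Proof.
rewrite /schoenberg; congr (limn (series _)); apply/funext => k.
rewrite /schoenberg_term mulrDr.
suff -> : 6 ^+ k.*2.+1 * n%:R = (2 * (3 * 6 ^ k.*2 * n))%:R :> R.
  by rewrite digit_periodic.
by rewrite exprS !natrM natrX; ring.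
Qed.

(** The exponents [k.*2.+1] grow by two, so term [k.+1] at [s] is half of term [k] at [36 * s]. *)
Lemma schoenberg_step s :
  schoenberg s = digit (6 * s) / 2 + schoenberg (36 * s) / 2.
Proof.
rewrite /schoenberg.
rewrite (lim_series_halving_step (b := schoenberg_term (36 * s))).
- by rewrite /schoenberg_term /halving !expr1 mulrC.
- move=> k; rewrite /schoenberg_term.
  have -> : 6 ^+ k.+1.*2.+1 * s = 6 ^+ k.*2.+1 * (36 * s).
    by rewrite doubleS !exprS; ring.
  by rewrite {1}/halving exprS -/(halving R _); field.
- exact/is_cvg_series_halving/schoenberg_term_le.
Qed.

(* The image of [0, 1/5] is invariant under the four homotheties of ratio 1/2
   centered at the vertices of the unit square. *)
Lemma schoenberg_self_similar (b c : bool) t : 0 <= t <= 5^-1 ->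
  exists2 s : R, 0 <= s <= 5^-1 &
    schoenberg s = (b%:R + schoenberg t) / 2 /\
    schoenberg (6 * s) = (c%:R + schoenberg (6 * t)) / 2.
Proof.
(* The base-6 digits [b], [c] are put in front of [t]; the first coordinate reads [b], the second
   [c]. The bound 1/5 is the fixed point of [t |-> (1 + t) / 6], hence is preserved. *)
move=> t5; pose r := (c%:R + t) / 6; pose s := (b%:R + r) / 6.
have r5 : 0 <= r <= 5^-1.
  by rewrite /r; move: t5 => /andP[? ?]; case: c {r s} => /=; apply/andP; split; lra.
have s5 : 0 <= s <= 5^-1.
  by rewrite /s; move: r5 => /andP[? ?]; case: b {s} => /=; apply/andP; split; lra.
exists s => //; split.
  rewrite schoenberg_step.
  have -> : 36 * s = t + (6 * b + c)%:R by rewrite /s /r natrD natrM; field.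
  have -> : 6 * s = b%:R + r by rewrite /s; field.
  by rewrite digitD// schoenberg_periodic; field.
have -> : 6 * s = r + b%:R by rewrite /s; field.
rewrite schoenberg_periodic schoenberg_step.
have -> : 36 * r = 6 * t + (6 * c)%:R by rewrite /r natrM; field.
have -> : 6 * r = c%:R + t by rewrite /r; field.
by rewrite digitD// schoenberg_periodic; field.
Qed.

(** One binary digit per coordinate selects the quarter of the square containing the point, and
    self-similarity halves the distance. The initial bound 4 is 2 per coordinate. *)
Lemma schoenberg_dense n x y : 0 <= x <= 1 -> 0 <= y <= 1 ->
  exists2 t : R, 0 <= t <= 5^-1 &
    `|x - schoenberg t| + `|y - schoenberg (6 * t)| <= halving R n * 4.
Proof.
elim: n x y => [|n IH] x y x01 y01.
  exists 0; first by apply/andP; split; lra.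
  rewrite /halving expr0 mul1r mulr0.
  have := schoenberg_le1 0; rewrite ler_norml => ?.
  suff z1 (z : R) : 0 <= z <= 1 -> `|z - schoenberg 0| <= 2.
    by have := z1 _ x01; have := z1 _ y01; lra.
  by move=> ?; rewrite ler_norml; apply/andP; split; lra.
have split_bit (z : R) : 0 <= z <= 1 -> exists b : bool, 0 <= 2 * z - b%:R <= 1.
  move=> z01; have [?|?] := leP z (2^-1).
    by exists false; rewrite /=; apply/andP; split; lra.
  by exists true; rewrite /=; apply/andP; split; lra.
have [b xb] := split_bit _ x01; have [c yc] := split_bit _ y01.
have [t t5 near_t] := IH _ _ xb yc.
have [s s5 [sx sy]] := schoenberg_self_similar b c t5.
exists s; rewrite ?sx ?sy //.
have half (z w r : R) : z - (w + r) / 2 = 2^-1 * (2 * z - w - r) by field.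
by rewrite !half !normrM gtr0_norm ?invr_gt0//; rewrite halvingS in near_t; lra.
Qed.

(** The distance to [(x, y)] attains its minimum on the compact [0, 1/5], and density forces this
    minimum to be 0. *)
Lemma schoenberg_surj x y : 0 <= x <= 1 -> 0 <= y <= 1 ->
  exists2 t : R, 0 <= t <= 1 & schoenberg t = x /\ schoenberg (6 * t) = y.
Proof.
move=> x01 y01.
pose dist t := `|x - schoenberg t| + `|y - schoenberg (6 * t)|.
have cdist : continuous dist.
  move=> t; apply: cvgD; apply: cvg_norm; apply: cvgB; try exact: cvg_cst.
    exact: schoenberg_continuous.
  apply: continuous_comp; last exact: schoenberg_continuous.
  by apply: cvgM; [exact: cvg_cst|exact: cvg_id].
have [|t t5 mint] := @EVT_min R dist 0 5^-1 _ (continuous_subspaceT cdist).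
  by rewrite invr_ge0.
exists t; first by move: t5; rewrite in_itv/= => /andP[? ?]; apply/andP; split; lra.
have : dist t <= 0.
  apply/ler_addgt0Pr => e e0; rewrite add0r.
  have e40 : 0 < e / 4 by rewrite divr_gt0.
  have [n ne] := halving_small e40.
  have [s s5 ds] := schoenberg_dense n x01 y01.
  by rewrite (le_trans (mint s _))// (le_trans ds)//; lra.
rewrite /dist => d0.
have := normr_ge0 (x - schoenberg t); have := normr_ge0 (y - schoenberg (6 * t)).
move=> n1 n2; split; apply/esym/eqP; rewrite -subr_eq0 -normr_eq0; apply/eqP; lra.
Qed.

End schoenberg.

(** * Sparse sums of rescaled pieces *)

Section bit_sequences.

(* Marks the codes of the finite prefixes of k: the mark sequences of distinct
   k's form an almost disjoint family of infinite subsets of nat. *)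
Definition prefix_mark (k : nat -> bool) n : bool :=
  if unpickle n is Some s then s == mkseq k (size s) else false.

Lemma prefix_mark_pickle k l m :
  prefix_mark k (pickle (mkseq l m)) = (mkseq l m == mkseq k m).
Proof. by rewrite /prefix_mark pickleK size_mkseq. Qed.

(** Each other [k i] differs from [k j] at some index; a prefix of [k j] reaching beyond all these
    indices is a prefix of none of them, and the codes of such prefixes are unbounded. *)
Lemma prefix_mark_isolate (J : eqType) (k : J -> nat -> bool) (s : seq J) j N :
    injective k ->
  exists n, [/\ (N <= n)%N, prefix_mark (k j) n &
    forall i, i \in s -> i != j -> ~~ prefix_mark (k i) n].
Proof.
move=> k_inj.
have [L splitL] : exists L, forall i, i \in s -> i != j ->
    exists2 p, (p < L)%N & k i p != k j p.
  elim: s => [|i s [L IH]]; first by exists 0%N.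
  have [ij|ij] := eqVneq i j.
    by exists L => i'; rewrite inE => /orP[/eqP ->|/IH//]; rewrite ij eqxx.
  have [p kp] : exists p, k i p != k j p.
    apply: contrapT => same; move/eqP: ij; apply; apply: k_inj.
    apply/funext => p; apply: contrapT => /eqP kp.
    by apply: same; exists p.
  exists (maxn L p.+1) => i'; rewrite inE => /orP[/eqP -> _|i's i'j].
    by exists p => //; rewrite leq_max ltnSn orbT.
  by have [q qL ?] := IH _ i's i'j; exists q; rewrite // leq_max qL.
pose code m := pickle (mkseq (k j) m).
have [m [Lm Nm]] : exists m, (L <= m)%N /\ (N <= code m)%N.
  apply: contrapT => none.
  have small m : (L <= m)%N -> (code m < N)%N.
    by move=> Lm; rewrite ltnNge; apply/negP => Nm; apply: none; exists m.
  (* Pigeonhole: the prefixes of lengths [L] to [L + N] would have [N + 1] distinct codes below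
     [N]. *)
  have : (size (map code (iota L N.+1)) <= size (iota 0 N))%N.
    apply: uniq_leq_size.
      rewrite map_inj_in_uniq ?iota_uniq// => m1 m2 _ _.
      move=> /(pcan_inj pickleK) /(congr1 size).
      by rewrite !size_mkseq.
    move=> n /mapP[m]; rewrite mem_iota => /andP[Lm _] ->.
    by rewrite mem_iota/= add0n small.
  by rewrite size_map !size_iota ltnn.
exists (code m); split => //.
  by rewrite /code prefix_mark_pickle.
move=> i si ij; rewrite /code prefix_mark_pickle; apply/negP => /eqP.
have [p pL kp] := splitL i si ij.
move=> /(congr1 (fun l => nth false l p)).
have pm := leq_trans pL Lm.
by rewrite !nth_mkseq// => /esym/eqP; rewrite (negbTE kp).
Qed.

End bit_sequences.

Section sparse_sums.
Variable R : realType.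
Implicit Types (c : nat -> bool) (h : R -> R).

(** The [n]-th argument runs through (-1, 2) as [t] runs from 4^-(n+1) to 4^-n, so the terms have
    disjoint windows when [h] vanishes off (-1, 2). The core [0, 1] is met at
    [t = (2 + u) / 4 ^+ n.+1]. *)
Definition sparse c h (t : R) : R := limn (series (fun n =>
  (c n)%:R * halving R n.+1 * h (4 ^+ n.+1 * t - 2))).

Section sparse_bounded.
Variables (c : nat -> bool) (h : R -> R).
Hypothesis h_le1 : forall s, `|h s| <= 1.

Lemma sparse_term_le n t :
  `|(c n)%:R * halving R n.+1 * h (4 ^+ n.+1 * t - 2)| <= halving R n.+1.
Proof.
have h0 := halving_gt0 R n.+1; rewrite !normrM (gtr0_norm h0).
rewrite -[leRHS]mulr1 ler_pM ?h_le1//; first by rewrite mulr_ge0// ltW.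
by case: (c n); rewrite ?normr1 ?mul1r// normr0 mul0r ltW.
Qed.

Lemma sparse_le1 t : `|sparse c h t| <= 1.
Proof. by apply: lim_series_halving_le1 => n; exact: sparse_term_le. Qed.

Lemma sparse_continuous : continuous h -> continuous (sparse c h).
Proof.
move=> hc; apply: (@continuous_lim_series R R
  (fun n t => (c n)%:R * halving R n.+1 * h (4 ^+ n.+1 * t - 2))) => [n t|].
  apply: cvgM; first exact: cvg_cst.
  apply: continuous_comp; last exact: hc.
  apply: cvgB; last exact: cvg_cst.
  by apply: cvgM; [exact: cvg_cst|exact: cvg_id].
by move=> n t; exact: sparse_term_le.
Qed.

End sparse_bounded.

(** At this parameter the [k]-th argument is at most 3/4 - 2 for [k < n] and at least 8 - 2 for
    [k > n], where [h] vanishes; only term [n] remains. *)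
Lemma sparse_eval c h n u : (forall s, 3 / 2 <= `|s - 2^-1| -> h s = 0) ->
  0 <= u <= 1 ->
  sparse c h ((2 + u) / 4 ^+ n.+1) = (c n)%:R * halving R n.+1 * h u.
Proof.
move=> h0 /andP[u0 u1].
have pow0 k : 0 < 4 ^+ k :> R by rewrite exprn_gt0.
have own : 4 ^+ n.+1 * ((2 + u) / 4 ^+ n.+1) - 2 = u.
  by rewrite mulrC divfK ?gt_eqF//; ring.
have other k : k != n -> h (4 ^+ k.+1 * ((2 + u) / 4 ^+ n.+1) - 2) = 0.
  move=> kn; apply: h0.
  have [lt_kn|lt_nk|eq_kn] := ltngtP k n; last by rewrite eq_kn eqxx in kn.
    have -> : 4 ^+ k.+1 * ((2 + u) / 4 ^+ n.+1) = (2 + u) / 4 ^+ (n - k) :> R.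
      rewrite -(subnKC (ltnW lt_kn)) addnC -addnS exprD addnK.
      by field; rewrite !gt_eqF.
    have : 4 <= 4 ^+ (n - k) :> R.
      by rewrite -[leLHS]expr1 ler_eXn2l ?subn_gt0// ltr1n.
    move: (4 ^+ _) => p p4.
    have : (2 + u) / p <= 3 / 4 by rewrite ler_pdivrMr; [nra|lra].
    by move=> ?; rewrite ler0_norm; lra.
  have -> : 4 ^+ k.+1 * ((2 + u) / 4 ^+ n.+1) = (2 + u) * 4 ^+ (k - n) :> R.
    rewrite -{1}(subnKC (ltnW lt_nk)) addnC -addnS exprD.
    by field; rewrite !gt_eqF.
  have : 4 <= 4 ^+ (k - n) :> R.
    by rewrite -[leLHS]expr1 ler_eXn2l ?subn_gt0// ltr1n.
  move: (4 ^+ _) => p p4.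
  have : 8 <= (2 + u) * p by nra.
  by move=> ?; rewrite ger0_norm; lra.
apply/cvg_lim => //; apply: cvg_near_cst; exists n.+1 => // m /= nm.
rewrite /series/= (bigD1_seq n) ?mem_index_iota ?iota_uniq//= own.
by rewrite big1 ?addr0// => k kn; rewrite other ?mulr0.
Qed.

Definition bump (s : R) : R := Num.max 0 (Num.min 1 (Num.min (s + 1) (2 - s))).

Lemma bump_continuous : continuous bump.
Proof.
apply: continuous_clip => s.
apply: (@continuous_min R R (fun s => s + 1) (fun s => 2 - s)).
  by apply: cvgD; [exact: cvg_id|exact: cvg_cst].
by apply: cvgB; [exact: cvg_cst|exact: cvg_id].
Qed.

Lemma bump_norm_le1 s : `|bump s| <= 1.
Proof.
by rewrite ger0_norm /bump ?le_max ?lexx// ge_max ler01 ge_min lexx.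
Qed.

Lemma bump1 s : 0 <= s <= 1 -> bump s = 1.
Proof.
move=> ?; rewrite /bump min_l ?max_r//.
by rewrite le_min; apply/andP; split; lra.
Qed.

Lemma bump0 s : 3 / 2 <= `|s - 2^-1| -> bump s = 0.
Proof.
move=> far; rewrite /bump max_l// !ge_min; apply/orP; right.
have [?|?] := ler0P (s - 2^-1).
  by apply/orP; left; move: far; rewrite ler0_norm//; lra.
by apply/orP; right; move: far; rewrite gtr0_norm//; lra.
Qed.

Definition windowed h s : R := bump s * h s.

Lemma windowed_continuous h : continuous h -> continuous (windowed h).
Proof. by move=> hc s; apply: cvgM; [exact: bump_continuous|exact: hc]. Qed.

Lemma windowed_le1 h s : (forall s, `|h s| <= 1) -> `|windowed h s| <= 1.
Proof. by move=> h1; rewrite normrM mulr_ile1// bump_norm_le1. Qed.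

Lemma sparse_windowed c h n u : 0 <= u <= 1 ->
  sparse c (windowed h) ((2 + u) / 4 ^+ n.+1) = (c n)%:R * halving R n.+1 * h u.
Proof.
move=> u01; rewrite sparse_eval// /windowed ?bump1 ?mul1r// => s far.
by rewrite bump0// mul0r.
Qed.

End sparse_sums.

(** * The generating family of curves *)

Section curves.
Variable R : realType.
Local Notation I := (unit_interval R).
Implicit Types (f g : curve R) (t : I).

Lemma clip_subproof (x : R) : Num.max 0 (Num.min 1 x) \in I.
Proof.
apply/mem_set; rewrite /unit_interval/= in_itv/= le_max lexx.
by rewrite ge_max ler01 ge_min lexx.
Qed.

(** The retraction of the line onto [I], by which curves become functions of a real variable. *)
Definition clip (x : R) : I := SigSub (clip_subproof x).

Lemma val_clip (x : R) : 0 <= x <= 1 -> \val (clip x) = x.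
Proof. by move=> /andP[x0 x1] /=; rewrite min_r// max_r. Qed.

Lemma unit_itvP t : 0 <= \val t <= 1.
Proof. by have : I (\val t) := set_valP t; rewrite /unit_interval/= in_itv. Qed.

Lemma clipK t : clip (\val t) = t.
Proof. by apply: val_inj; rewrite val_clip// unit_itvP. Qed.

Lemma clip_continuous : continuous clip.
Proof.
apply: continuous_comp_initial => x.
by apply: (@continuous_clip R R idfun) => y; exact: cvg_id.
Qed.

Lemma val_continuous : continuous (\val : I -> R).
Proof. exact: initial_continuous. Qed.

Lemma curve_continuous f : continuous (curve_fun f).
Proof. exact: (@cts_fun _ _ f). Qed.

Lemma curve_clip_continuous f : continuous (curve_fun f \o clip).
Proof.
by move=> x; apply: continuous_comp; [exact: clip_continuous|exact: curve_continuous].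
Qed.

Lemma continuous_fst (T : topologicalType) (F : T -> R * R) :
  continuous F -> continuous (fun x => (F x).1).
Proof.
by move=> Fc x; apply: (@continuous_comp _ _ _ F fst); [exact: Fc|exact: cvg_fst].
Qed.

Lemma continuous_snd (T : topologicalType) (F : T -> R * R) :
  continuous F -> continuous (fun x => (F x).2).
Proof.
by move=> Fc x; apply: (@continuous_comp _ _ _ F snd); [exact: Fc|exact: cvg_snd].
Qed.

Lemma curve_fun_sum (J : Type) (s : seq J) (c : J -> R) (b : J -> curve R) t :
  curve_fun (\sum_(i <- s) c i *: b i) t =
  (\sum_(i <- s) c i * (curve_fun (b i) t).1,
   \sum_(i <- s) c i * (curve_fun (b i) t).2).
Proof.
elim: s => [|i s IH]; first by rewrite !big_nil.
rewrite !big_cons -[LHS]/(c i *: curve_fun (b i) t +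
  curve_fun (\sum_(j <- s) c j *: b j) t).
by rewrite IH.
Qed.

(** * Coding curves by bit sequences *)

Lemma continuous_eq_rat (h : R -> R) : continuous h ->
  (forall q : rat, h (ratr q) = 0) -> forall x, h x = 0.
Proof.
move=> hc h0 x; apply: contrapT => /eqP hx.
have hx0 : 0 < `|h x| by rewrite normr_gt0.
have /cvgrPdist_lt/(_ _ hx0) := hc x.
rewrite nbhsE => -[V [oV Vx] Vh].
have [r [Vr [q _ qr]]] := dense_rat (ex_intro _ x Vx) oV.
by have := Vh _ Vr; rewrite /= -qr h0 subr0 ltxx.
Qed.

Lemma ratr_lt_inj (x y : R) : (forall q : rat, (ratr q < x) = (ratr q < y)) -> x = y.
Proof.
move=> xy; apply: contrapT => /eqP; rewrite neq_lt => /orP[] /rat_in_itvoo[q].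
  by rewrite in_itv/= => /andP[/ltW xq qy]; move: (xy q); rewrite qy ltNge xq.
by rewrite in_itv/= => /andP[/ltW yq qx]; move: (xy q); rewrite qx ltNge yq.
Qed.

(* A curve is coded by the Dedekind cuts of its coordinates at rational
   parameters. *)
Definition curve_code (p : curve R * nat) (i : nat) : bool :=
  match (unpickle i : option (rat * rat * bool + nat)) with
  | Some (inl (q, r, b)) =>
      let z := curve_fun p.1 (clip (ratr q)) in
      ratr r < (if b then z.1 else z.2)
  | Some (inr n) => n == p.2
  | None => false
  end.

(** The cuts determine both coordinates at rational parameters, hence everywhere by continuity; the
    [inr] bits recover the index. *)
Lemma curve_code_inj : injective curve_code.
Proof.
move=> [f n] [g m] fg.
have decode (j : rat * rat * bool + nat) : curve_code (f, n) (pickle j) = curve_code (g, m) (pickle j).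
  by rewrite fg.
have nm : n = m.
  have := decode (inr n); rewrite /curve_code pickleK/= eqxx.
  by move/esym/eqP.
have cut q r b := decode (inl (q, r, b)).
rewrite /curve_code in cut.
have fg1 x : (curve_fun f (clip x)).1 - (curve_fun g (clip x)).1 = 0.
  apply: (@continuous_eq_rat (fun x =>
    (curve_fun f (clip x)).1 - (curve_fun g (clip x)).1)).
    by move=> y; apply: cvgB; apply: (continuous_fst (@curve_clip_continuous _)).
  move=> q; apply/eqP; rewrite subr_eq0; apply/eqP/ratr_lt_inj => r.
  by have := cut q r true; rewrite !pickleK.
have fg2 x : (curve_fun f (clip x)).2 - (curve_fun g (clip x)).2 = 0.
  apply: (@continuous_eq_rat (fun x =>
    (curve_fun f (clip x)).2 - (curve_fun g (clip x)).2)).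
    by move=> y; apply: cvgB; apply: (continuous_snd (@curve_clip_continuous _)).
  move=> q; apply/eqP; rewrite subr_eq0; apply/eqP/ratr_lt_inj => r.
  by have := cut q r false; rewrite !pickleK.
rewrite nm; congr pair; apply: val_inj; apply/funext => t /=.
rewrite -(clipK t); apply/eqP; rewrite -subr_eq0; apply/eqP.
apply/pair_equal_spec; split; [exact: fg1|exact: fg2].
Qed.

(** * The spikes: continuity and density of their span *)

Definition schoenberg6 (s : R) : R := schoenberg (6 * s).

Lemma schoenberg6_continuous : continuous schoenberg6.
Proof.
move=> s; apply: continuous_comp; last exact: schoenberg_continuous.
by apply: cvgM; [exact: cvg_cst|exact: cvg_id].
Qed.

Definition wiggle (h : R -> R) (p : curve R * nat) : R -> R :=
  sparse (prefix_mark (curve_code p)) (windowed h).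

Lemma wiggle_le1 h p x : (forall s, `|h s| <= 1) -> `|wiggle h p x| <= 1.
Proof. by move=> h1; apply: sparse_le1 => s; exact: windowed_le1. Qed.

Lemma wiggle_continuous h p : (forall s, `|h s| <= 1) -> continuous h ->
  continuous (wiggle h p).
Proof.
move=> h1 hc; apply: sparse_continuous; first by move=> s; exact: windowed_le1.
exact: windowed_continuous.
Qed.

(* The curve f is frozen on [0, 2^-n], so that there only the small sum of
   space-filling pieces is visible. *)
Definition spike_fun (p : curve R * nat) (x : R) : R * R :=
  let z := curve_fun p.1 (clip (Num.max x (halving R p.2))) in
  (z.1 + halving R p.2 * wiggle (@schoenberg R) p x,
   z.2 + halving R p.2 * wiggle schoenberg6 p x).

Lemma spike_fun_continuous p : continuous (spike_fun p).
Proof.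
have zc : continuous (fun x => curve_fun p.1 (clip (Num.max x (halving R p.2)))).
  move=> x; apply: (@continuous_comp _ _ _ (fun x : R => Num.max x (halving R p.2))
    (curve_fun p.1 \o clip)); last exact: curve_clip_continuous.
  apply: (@continuous_max R R idfun (fun=> halving R p.2)); first exact: cvg_id.
  exact: cst_continuous.
have wc h : (forall s, `|h s| <= 1) -> continuous h ->
    continuous (fun x => halving R p.2 * wiggle h p x).
  move=> h1 hc x; apply: cvgM; first exact: cvg_cst.
  exact: wiggle_continuous.
have pair_continuous (f1 f2 : R -> R) : continuous f1 -> continuous f2 ->
    continuous (fun x => (f1 x, f2 x)).
  by move=> c1 c2 x; exact: (cvg_pair (c1 x) (c2 x)).
apply: pair_continuous => x; apply: cvgD.
- exact: continuous_fst zc x.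
- by apply: wc => [s|]; [exact: schoenberg_le1|exact: schoenberg_continuous].
- exact: continuous_snd zc x.
- by apply: wc => [s|]; [exact: schoenberg_le1|exact: schoenberg6_continuous].
Qed.

Lemma spike_continuous p : continuous (spike_fun p \o (\val : I -> R)).
Proof.
by move=> t; apply: continuous_comp; [exact: val_continuous|exact: spike_fun_continuous].
Qed.

Definition spike p : curve R := curve_Sub (mem_set (@spike_continuous p)).

Lemma spikeE p t : curve_fun (spike p) t = spike_fun p (\val t).
Proof. by []. Qed.

(** Freezing [f] on a short interval costs little by continuity at 0, and the added term is at most
    2^-n in each coordinate. *)
Lemma spike_near f (e : R) : 0 < e ->
  exists n, forall t, `|curve_fun f t - curve_fun (spike (f, n)) t| < e.
Proof.
move=> e0; have e20 : 0 < e / 2 by rewrite divr_gt0.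
have e40 : 0 < e / 4 by rewrite divr_gt0.
have /cvgrPdist_lt/(_ _ e40) := @curve_clip_continuous f 0.
move=> /nbhs_normP[d /= d0 fd].
have m0 : 0 < Num.min d (e / 2) by rewrite lt_min d0 e20.
have [n] := halving_small m0; rewrite lt_min => /andP[nd ne].
have n0 := halving_gt0 R n.
pose F := curve_fun f \o clip.
suff near_f y : 0 <= y -> `|F y - spike_fun (f, n) y| < e.
  exists n => t; have /andP[t0 _] := unit_itvP t.
  by have := near_f _ t0; rewrite /F /comp clipK.
move=> y0; set x := Num.max y (halving R n).
have F_near0 z : 0 <= z <= halving R n -> `|F 0 - F z| < e / 4.
  move=> /andP[z0 zn]; apply: fd => /=.
  by rewrite sub0r normrN ger0_norm// (le_lt_trans zn).
have Fx : `|F y - F x| < e / 2.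
  rewrite /x; have [ny|yn] := leP (halving R n) y.
    by rewrite subrr normr0.
  rewrite (le_lt_trans (ler_distD (F 0) _ _))// [`|F y - _|]distrC.
  have := F_near0 y; rewrite y0 ltW// => /(_ isT) ?.
  have := F_near0 (halving R n); rewrite lexx ltW// => /(_ isT) ?.
  lra.
have small h : (forall s, `|h s| <= 1) ->
    `|halving R n * wiggle h (f, n) y| < e / 2.
  move=> h1; rewrite normrM gtr0_norm// (le_lt_trans _ ne)//.
  by rewrite ler_piMr ?wiggle_le1// ltW.
have small1 := small _ (@schoenberg_le1 R).
have small2 := small schoenberg6 (fun s => schoenberg_le1 _).
have split_lt (a b w : R) : `|a - b| < e / 2 -> `|w| < e / 2 ->
    `|a - (b + w)| < e.
  move=> ab we; rewrite opprD addrA (le_lt_trans (ler_normB _ _))//.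
  by rewrite [ltRHS]splitr ltrD.
move: Fx; rewrite !ProdNormedZmodule.prod_normE !gt_max => /andP[Fx1 Fx2].
apply/andP; split.
  exact: (split_lt (F y).1 (F x).1 _ Fx1 small1).
exact: (split_lt (F y).2 (F x).2 _ Fx2 small2).
Qed.

Lemma spike_dense : dense (lin_span (range spike)).
Proof.
move=> V [f Vf] oV.
have /nbhs_curveP[e e0 eV] : nbhs f V by apply: open_nbhs_nbhs.
have [n fn] := spike_near f e0.
exists (spike (f, n)); split; first by apply: eV => t; exact: fn.
by apply: sub_lin_span; exists (f, n).
Qed.

(** * Nonempty interior for combinations of spikes *)

Lemma interior_square (S : set (R * R)) (a x0 y0 : R) : a != 0 ->
  (forall x y, 0 <= x <= 1 -> 0 <= y <= 1 -> S (x0 + a * x, y0 + a * y)) ->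
  S° !=set0.
Proof.
(* The centre of the square; [a] may be negative, hence the radius [|a| / 2]. *)
move=> a0 sq; exists (x0 + a / 2, y0 + a / 2).
have a20 : 0 < `|a| / 2 by rewrite divr_gt0 ?normr_gt0.
apply/nbhs_ballP; exists (`|a| / 2) => //= -[x y] [/= bx by_].
have coord (z w : R) : ball (z + a / 2) (`|a| / 2) w ->
    0 <= (w - z) / a <= 1 /\ w = z + a * ((w - z) / a).
  rewrite -ball_normE /= => zw; split; last by field.
  have : `|2^-1 - (w - z) / a| < 2^-1.
    have -> : 2^-1 - (w - z) / a = (z + a / 2 - w) / a by field.
    by rewrite normrM normfV ltr_pdivrMr ?normr_gt0// [_^-1 * `|a|]mulrC.
  by rewrite ltr_norml => /andP[? ?]; apply/andP; split; lra.
by have [x01 ->] := coord _ _ bx; have [y01 ->] := coord _ _ by_; exact: sq.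
Qed.

(** On a window marked by [p] alone, where all curves of [s] are frozen, the combination is a
    constant plus a nonzero multiple of Schoenberg's curve. *)
Lemma spike_comb_TSF (s : seq (curve R * nat)) (c : curve R * nat -> R) p :
  uniq s -> p \in s -> c p != 0 -> TSF (\sum_(i <- s) c i *: spike i).
Proof.
move=> us ps cp.
(* Taking [m] at least every freezing index puts the window, of order 4^-m, inside each interval
   [0, 2^-i.2]. *)
have [m [sm pm other]] := prefix_mark_isolate s p
  (\max_(i <- s) i.2) curve_code_inj.
pose x u : R := (2 + u) / 4 ^+ m.+1.
have x_small u i : 0 <= u <= 1 -> i \in s -> 0 <= x u <= halving R i.2.
  move=> /andP[u0 u1] si.
  have le_im : (i.2 <= m)%N by apply: leq_trans sm; exact: leq_bigmax_seq.
  have -> : x u = (2 + u) / 4 * halving R m * halving R m.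
    have four : 4 ^+ m.+1 = 4 * (2 ^+ m * 2 ^+ m) :> R.
      by rewrite exprS -exprMn; congr (_ * _ ^+ _); ring.
    by rewrite /x four /halving exprVn; field; rewrite gt_eqF.
  have h1 k : 0 < halving R k <= 1.
    by rewrite halving_gt0 halving_le1.
  have := halving_le R le_im.
  have := h1 m; have := h1 i.2; move: (halving _ _) (halving _ _) => A B.
  move=> /andP[A0 A1] /andP[B0 B1] BA; apply/andP; split; nra.
have x01 u : 0 <= u <= 1 -> 0 <= x u <= 1.
  move=> u01; have /andP[-> xh] := x_small u p u01 ps.
  by rewrite (le_trans xh)// halving_le1.
pose z i := curve_fun i.1 (clip (halving R i.2)).
have spike_x u i : 0 <= u <= 1 -> i \in s ->
    curve_fun (spike i) (clip (x u)) =
    ((z i).1 + halving R i.2 * wiggle (@schoenberg R) i (x u),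
     (z i).2 + halving R i.2 * wiggle schoenberg6 i (x u)).
  move=> u01 si; have /andP[_ xi] := x_small u i u01 si.
  by rewrite spikeE (val_clip (x01 u u01)) /spike_fun (max_r xi).
(* The factors are the coefficient of [p], the amplitude of its spike, and the weight of term [m] in
   the sparse sum. *)
pose a := c p * (halving R p.2 * halving R m.+1).
have a0 : a != 0 by rewrite !mulf_neq0// gt_eqF// halving_gt0.
have coord (h : R -> R) (w : R * R -> R) u : 0 <= u <= 1 ->
    \sum_(i <- s) c i * (w (z i) + halving R i.2 * wiggle h i (x u)) =
    \sum_(i <- s) c i * w (z i) + a * h u.
  move=> u01; under eq_bigr do rewrite mulrDr.
  rewrite big_split/=; congr (_ + _); rewrite (bigD1_seq p)//=.
  rewrite big1_seq ?addr0 => [|i /andP[ip si]].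
    by rewrite /wiggle sparse_windowed// pm mul1r /a !mulrA.
  by rewrite /wiggle sparse_windowed// (negbTE (other i si ip)) !mul0r !mulr0.
apply: (@interior_square _ a (\sum_(i <- s) c i * (z i).1)
  (\sum_(i <- s) c i * (z i).2)) => // x1 x2 x1P x2P.
have [u u01 [<- <-]] := schoenberg_surj x1P x2P.
exists (clip (x u)) => //.
rewrite curve_fun_sum; congr pair.
  rewrite -[RHS](coord (@schoenberg R) fst u u01); apply: eq_big_seq => i si.
  by rewrite spike_x.
rewrite -[RHS](coord schoenberg6 snd u u01); apply: eq_big_seq => i si.
by rewrite spike_x.
Qed.

Lemma TSF0 : ~ @TSF R 0.
Proof.
move=> [z]; rewrite /interior/= => /nbhs_ballP[e /= e0 ze].
have in0 w : ball z e w -> w = 0 by move=> /ze[t _ <-].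
have z0 : z = 0 by apply: in0; exact: ballxx.
have : (e / 2, 0) = 0 :> R * R.
  apply: in0; rewrite z0; split => /=; last exact: ballxx.
  by rewrite -ball_normE /= sub0r normrN gtr0_norm; lra.
by move=> [e2]; lra.
Qed.

Lemma card_curve_nat : ([set: curve R] #<= [set: curve R * nat])%card.
Proof.
have -> : [set: curve R] = fst @` [set: curve R * nat].
  by apply/seteqP; split => // f _; exists (f, 0%N).
exact: card_image_le.
Qed.

Lemma TSF_maximal_dense_lineable : maximal_dense_lineable (@TSF R).
Proof.
apply: (maximal_dense_lineable_family card_curve_nat spike_dense TSF0).
exact: spike_comb_TSF.
Qed.

(** For arbitrary sets, measurable or not: the integral is a supremum over simple functions below
    the integrand, and sections are compared by monotonicity of the outer measure. *)
Lemma product_lebesgue_measure_subset (A B : set (R * R)) : A `<=` B ->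
  ((lebesgue_measure \x lebesgue_measure) A <=
   (lebesgue_measure \x lebesgue_measure) B)%E.
Proof.
move=> AB; rewrite /product_measure1 !ge0_integralTE//.
apply: ereal_sup_le => _ [h /= hA <-]; exists h => //= x.
apply: (le_trans (hA x)); apply: le_mu_ext => y.
by rewrite /xsection/= !inE => /AB.
Qed.

Lemma TSF_lambda_SF : @TSF R `<=` @lambda_SF R.
Proof.
move=> f [z /nbhs_ballP[e /= e0 ze]].
apply: lt_le_trans (product_lebesgue_measure_subset ze).
(* A ball of the plane is a product of two intervals, both of positive length. *)
rewrite -[ball z e]/(ball z.1 e `*` ball z.2 e) product_measure1E; last 2 first.
- by rewrite ball_itv; exact: measurable_itv.
- by rewrite ball_itv; exact: measurable_itv.
have ball_gt0 (x : R) : (0 < lebesgue_measure (ball x e))%E.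
  by rewrite lebesgue_measure_ball ?ltW// lte_fin pmulrn_lgt0.
exact: mule_gt0 (ball_gt0 _) (ball_gt0 _).
Qed.

End curves.

Theorem theorem4p6 (R : realType) :
  maximal_dense_lineable (@TSF R) /\ maximal_dense_lineable (@lambda_SF R).
Proof.
have TSF_mdl := @TSF_maximal_dense_lineable R.
by split; last exact: maximal_dense_lineable_sub (@TSF_lambda_SF R) TSF_mdl.
Qed.
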